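(* If $\Gamma$ is a locally finitely determined group of local similarities on a compact ultrametric space $X$, then $\Gamma$ (with the discrete topology) has the Haagerup property.
   Context: An ultrametric space is a metric space $(X,d)$ with $d(x,y)\le\max\{d(x,z),d(z,y)\}$ for all $x,y,z\in X$. Write $B(x,\epsilon)=\{y : d(x,y)<\epsilon\}$ and $\bar B(x,\epsilon)=\{y : d(x,y)\le\epsilon\}$ for open and closed balls ($\epsilon>0$). For $\lambda>0$, a map $g\colon X\to Y$ of metric spaces is a $\lambda$-similarity if $d_Y(gx,gy)=\lambda d_X(x,y)$ for all $x,y\in X$; a similarity is a $\lambda$-similarity for some $\lambda>0$. A homeomorphism $g\colon X\to X$ is a local similarity if for every $x\in X$ there exist $r,\lambda>0$ such that $g$ restricts to a surjective $\lambda$-similarity $B(x,r)\to B(gx,\lambda r)$. $LS(X)$ is the group of all local similarities from $X$ onto $X$; its subgroups are given the discrete topology. Let $X$ be a compact ultrametric space. A finite similarity structure for $X$ is a function $\mathrm{Sim}$ assigning to each ordered pair $B_1,B_2$ of closed balls in $X$ a (possibly empty) finite set $\mathrm{Sim}(B_1,B_2)$ of surjective similarities $B_1\to B_2$ such that for all closed balls $B_1,B_2,B_3$ in $X$: (1) $\mathrm{id}_{B_1}\in\mathrm{Sim}(B_1,B_1)$; (2) if $h\in\mathrm{Sim}(B_1,B_2)$ then $h^{-1}\in\mathrm{Sim}(B_2,B_1)$; (3) if $h_1\in\mathrm{Sim}(B_1,B_2)$ and $h_2\in\mathrm{Sim}(B_2,B_3)$ then $h_2h_1\in\mathrm{Sim}(B_1,B_3)$;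 (4) if $h\in\mathrm{Sim}(B_1,B_2)$ and $B_3\subseteq B_1$ then $h|B_3\in\mathrm{Sim}(B_3,h(B_3))$. A subgroup $\Gamma\le LS(X)$ is locally determined by $\mathrm{Sim}$ if for every $g\in\Gamma$ and every $x\in X$ there exist $r,\lambda>0$ such that $g|\colon\bar B(x,r)\to\bar B(gx,\lambda r)$ is a surjective $\lambda$-similarity belonging to $\mathrm{Sim}(\bar B(x,r),\bar B(gx,\lambda r))$. $\Gamma$ is a locally finitely determined group of local similarities on $X$ if it is locally determined by some finite similarity structure for $X$. A countable discrete group $\Gamma$ has the Haagerup property if there exists an isometric action of $\Gamma$ on some affine Hilbert space $\mathcal H$ that is metrically proper: for every bounded subset $B\subseteq\mathcal H$, the set $\{g\in\Gamma : gB\cap B\ne\emptyset\}$ is finite. *)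

(* Defs.v *)
From HB Require Import structures.
From mathcomp Require Import all_boot all_order all_algebra.
From mathcomp Require Import all_classical all_reals all_analysis.

Set Implicit Arguments.
Unset Strict Implicit.
Unset Printing Implicit Defensive.

Import Order.TTheory GRing.Theory Num.Theory.
Import numFieldNormedType.Exports.

Local Open Scope classical_set_scope.
Local Open Scope ring_scope.

Definition ultrametric (R : realType) (X : metricType R) : Prop :=
  forall x y z : X, mdist x y <= Num.max (mdist x z) (mdist z y).

Section LocalSimilarities.
Context {R : realType} {X : metricType R}.
Implicit Types (f g : X -> X) (A B : set X) (x y z : X) (r l : R).

Definition homeomorphism g : Prop :=
  continuous g /\ exists h, [/\ continuous h, cancel g h & cancel h g].

Definition restricts_to_similarity l g A B : Prop :=
  (forall y z, A y -> A z -> mdist (g y) (g z) = l * mdist y z) /\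
  g @` A = B.

(* In a metricType, [ball x r] is [set y | mdist x y < r] (ballEmdist). *)
Definition local_similarity g : Prop := homeomorphism g /\
  forall x, exists r l : R, [/\ 0 < r, 0 < l &
    restricts_to_similarity l g (ball x r) (ball (g x) (l * r))].

Lemma restricts_to_similarity_shrink g x r l s : 0 < l -> 0 < s -> s <= r ->
  restricts_to_similarity l g (ball x r) (ball (g x) (l * r)) ->
  restricts_to_similarity l g (ball x s) (ball (g x) (l * s)).
Proof.
move=> l0 s0 sr [gl gr].
have xr : ball x r x by apply: ballxx; exact: lt_le_trans sr.
have sub z : ball x s z -> ball x r z by exact: le_ball.
split; first by move=> y z /sub ? /sub ?; exact: gl.
apply/seteqP; split => [_ [z xz <-]|y ys].
  by move: (xz); rewrite !ballEmdist /= gl ?ltr_pM2l//; exact: sub.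
have : ball (g x) (l * r) y by apply: le_ball ys; rewrite ler_pM2l.
rewrite -gr => -[z xz zy]; exists z => //; move: ys.
by rewrite -zy !ballEmdist /= gl ?ltr_pM2l.
Qed.

Lemma local_similarity_id : local_similarity idfun.
Proof.
split.
  by split; [move=> x; exact: cvg_id|exists idfun; split => // x; exact: cvg_id].
move=> x; exists 1, 1; split => //; split; last by rewrite mul1r image_id.
by move=> y z _ _; rewrite mul1r.
Qed.

Lemma local_similarity_comp f g :
  local_similarity f -> local_similarity g -> local_similarity (f \o g).
Proof.
move=> [[cf [f' [cf' fK fK']]] lf] [[cg [g' [cg' gK gK']]] lg]; split.
  split; first by move=> x; apply: continuous_comp; [exact: cg|exact: cf].
  exists (g' \o f'); split; [|exact: can_comp|exact: can_comp].
  by move=> x; apply: continuous_comp; [exact: cf'|exact: cg'].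
move=> x; have [r1 [l1 [r10 l10 s1]]] := lg x.
have [r2 [l2 [r20 l20 s2]]] := lf (g x).
pose r := Num.min r1 (r2 / l1).
have r0 : 0 < r by rewrite lt_min r10 divr_gt0.
have rr1 : r <= r1 by rewrite ge_min lexx.
have rr2 : l1 * r <= r2 by rewrite mulrC -ler_pdivlMr// ge_min lexx orbT.
have [d1 i1] := restricts_to_similarity_shrink l10 r0 rr1 s1.
have lr0 : 0 < l1 * r by rewrite mulr_gt0.
have [d2 i2] := restricts_to_similarity_shrink l20 lr0 rr2 s2.
exists r, (l2 * l1); split => //; first by rewrite mulr_gt0.
split; last by rewrite -image_comp i1 i2 mulrA.
have sub z : ball x r z -> ball (g x) (l1 * r) (g z).
  by move=> xz; rewrite -i1; exists z.
by move=> y z xy xz /=; rewrite d2 ?d1 ?mulrA//; exact: sub.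
Qed.

Lemma local_similarity_inv f g : local_similarity f ->
  cancel f g -> cancel g f -> local_similarity g.
Proof.
move=> [[cf [f' [cf' fK fK']]] lf] fg gf.
have -> : g = f' by apply/funext => x; rewrite -[in LHS](fK' x) fg.
split; first by split => //; exists f.
move=> x; have [r [l [r0 l0 [d i]]]] := lf (f' x).
rewrite fK' in i; exists (l * r), l^-1; split; rewrite ?mulr_gt0 ?invr_gt0//.
rewrite mulKf ?gt_eqF// -i; split.
  by move=> _ _ [y xy <-] [z xz <-]; rewrite !fK d// mulKf ?gt_eqF.
apply/seteqP; split => [_ [_ [y xy <-] <-]|y xy] /=; first by rewrite fK.
by exists (f y); [exists y|rewrite fK].
Qed.

End LocalSimilarities.

Definition LS (R : realType) (X : metricType R) : Type :=
  [set g : X -> X | local_similarity g].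

Section LSGroup.
Context {R : realType} {X : metricType R}.
Implicit Types f g h : LS X.

HB.instance Definition _ := Choice.copy (LS X)
  [set g : X -> X | local_similarity g].

Definition ls_fun g : X -> X := val g.

Lemma ls_funP g : local_similarity (ls_fun g).
Proof. exact: set_mem (valP g). Qed.

Lemma ls_fun_inj : injective ls_fun.
Proof. exact: val_inj. Qed.

Let mk (g : X -> X) (gP : local_similarity g) : LS X := exist _ g (mem_set gP).

Definition ls_one : LS X := mk local_similarity_id.

Definition ls_mul f g : LS X :=
  mk (local_similarity_comp (ls_funP f) (ls_funP g)).

Let invP g : exists k : X -> X, cancel (ls_fun g) k /\ cancel k (ls_fun g).
Proof. by have [[_ [h [_ gK hK]]] _] := ls_funP g; exists h. Qed.

Definition ls_inv g : LS X := let P := projT2 (cid (invP g)) in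
  mk (local_similarity_inv (ls_funP g) (proj1 P) (proj2 P)).

Lemma ls_invK g : cancel (ls_fun g) (ls_fun (ls_inv g)).
Proof. exact: (proj1 (projT2 (cid (invP g)))). Qed.

Lemma ls_Kinv g : cancel (ls_fun (ls_inv g)) (ls_fun g).
Proof. exact: (proj2 (projT2 (cid (invP g)))). Qed.

Let mulA : associative ls_mul.
Proof. by move=> f g h; apply: ls_fun_inj. Qed.
Let mul1 : left_id ls_one ls_mul.
Proof. by move=> f; apply: ls_fun_inj. Qed.
Let mulr1 : right_id ls_one ls_mul.
Proof. by move=> f; apply: ls_fun_inj. Qed.
Let mulV : left_inverse ls_one ls_inv ls_mul.
Proof. by move=> f; apply: ls_fun_inj; apply/funext => x; exact: ls_invK. Qed.
Let mulrV : right_inverse ls_one ls_inv ls_mul.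
Proof. by move=> f; apply: ls_fun_inj; apply/funext => x; exact: ls_Kinv. Qed.

HB.instance Definition _ := isGroup.Build (LS X) mulA mul1 mulr1 mulV mulrV.

End LSGroup.

Coercion ls_fun : LS >-> Funclass.

Section Subgroup.
Context {G : groupType}.

Definition subgroup (S : groupClosed G) : Type := {g : G | g \in S}.

Variable S : groupClosed G.

Let group_closedS : group_closed S.
Proof.
split; first exact: gpred1.
by move=> x y xS yS; apply: gpredM => //; exact: gpredVr.
Qed.

HB.instance Definition _ := SubChoice.on (subgroup S).
HB.instance Definition _ :=
  SubChoice_isSubGroup.Build G (fun g => g \in S) (subgroup S) group_closedS.

End Subgroup.

Section FiniteSimilarityStructure.
Context {R : realType} {X : metricType R}.

(* Not the library's [closed_ball], which is the topological closure of the
   open ball; in an ultrametric space open balls are already closed. *)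
Definition cball (x : X) (r : R) : set X := [set y | mdist x y <= r].

(* Balls are compared as sets: a ball may have several centres and radii. *)
Record cballType := CBallType {
  cball_set :> set X;
  cball_setP : exists (x : X) (r : R), 0 < r /\ cball_set = cball x r }.

Lemma cball_subproof (x : X) (r : {posnum R}) :
  exists (y : X) (s : R), 0 < s /\ cball x r%:num = cball y s.
Proof. by exists x, r%:num. Qed.

Definition mk_cball (x : X) (r : {posnum R}) : cballType :=
  CBallType (cball_subproof x r).

Definition surj_similarity (B1 B2 : set X) (l : R) (h : B1 -> B2) : Prop :=
  (forall y z, mdist (val (h y)) (val (h z)) = l * mdist (val y) (val z)) /\
  set_surj setT setT h.

(* [k : B3 -> B4] is the restriction of [h : B1 -> B2] to [B3], with
   codomain cut down to [B4 = h(B3)]. *)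
Definition is_restriction (B1 B2 B3 B4 : set X)
    (h : B1 -> B2) (k : B3 -> B4) : Prop :=
  [/\ B3 `<=` B1,
      B4 = [set val (h y) | y in [set y : B1 | B3 (val y)]] &
      forall (y : B1) (z : B3), val y = val z -> val (k z) = val (h y)].

Record finite_similarity_structure
    (Sim : forall B1 B2 : cballType, set (B1 -> B2)) : Prop := {
  Sim_finite : forall B1 B2, finite_set (Sim B1 B2);
  Sim_similarity : forall (B1 B2 : cballType) (h : B1 -> B2), Sim B1 B2 h ->
    exists2 l : R, 0 < l & surj_similarity l h;
  Sim_id : forall B1 : cballType, Sim B1 B1 idfun;
  Sim_inv : forall (B1 B2 : cballType) (h : B1 -> B2) (h' : B2 -> B1),
    Sim B1 B2 h -> cancel h h' -> cancel h' h -> Sim B2 B1 h';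
  Sim_comp : forall (B1 B2 B3 : cballType) (h1 : B1 -> B2) (h2 : B2 -> B3),
    Sim B1 B2 h1 -> Sim B2 B3 h2 -> Sim B1 B3 (h2 \o h1);
  Sim_restrict : forall (B1 B2 B3 B4 : cballType)
      (h : B1 -> B2) (k : B3 -> B4),
    Sim B1 B2 h -> is_restriction h k -> Sim B3 B4 k }.

(* [Sim_restrict] applies to every ball [B3] contained in [B1], because the
   image [h(B3)] is again a closed ball. *)
Lemma similarity_image_cball (B1 B2 B3 : cballType) (h : B1 -> B2) (l : R) :
  ultrametric X -> 0 < l -> surj_similarity l h -> B3 `<=` B1 ->
  exists (B4 : cballType) (k : B3 -> B4), is_restriction h k.
Proof.
move=> Xu l0 [hl hs] B31.
pose C : set X := [set val (h y) | y in [set y : B1 | cball_set B3 (val y)]].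
have [x [r [r0 B3E']]] := cball_setP B3.
have B3E z : cball_set B3 z = (mdist x z <= r) by rewrite B3E'.
have [x2 [r2 [r20 B2E']]] := cball_setP B2.
have B2E z : cball_set B2 z = (mdist x2 z <= r2) by rewrite B2E'.
have B3x : cball_set B3 x by rewrite B3E mdistxx ltW.
pose x1 : B1 := exist _ x (mem_set (B31 _ B3x)).
have B2P (y : B2) : mdist x2 (val y) <= r2.
  by rewrite -B2E; exact/set_mem/valP.
pose s := Num.min (l * r) r2.
have s0 : 0 < s by rewrite lt_min mulr_gt0.
have CE : C = cball (val (h x1)) s.
  apply/seteqP; split => [_ [y B3y <-]|z /=].
    rewrite /cball /= le_min; apply/andP; split.
      by rewrite hl ler_pM2l//; move: B3y; rewrite /= B3E.
    by apply: (le_trans (Xu _ _ x2)); rewrite ge_max metric_sym !B2P.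
  rewrite /cball /= le_min => /andP[zr zr2].
  have B2z : cball_set B2 z.
    rewrite B2E; apply: (le_trans (Xu _ _ (val (h x1)))).
    by rewrite ge_max B2P.
  have [y _ yz] := hs (exist _ z (mem_set B2z)) I.
  have zE : val (h y) = z by rewrite yz.
  exists y => //=; rewrite B3E; move: zr.
  by rewrite -zE hl ler_pM2l.
have CP : exists (y : X) (t : R), 0 < t /\ C = cball y t by exists (val (h x1)), s.
have B1P (z : B3) : val z \in (B1 : set X).
  by apply/mem_set/B31/set_mem/valP.
have kP (z : B3) : val (h (exist _ (val z) (B1P z))) \in C.
  by apply/mem_set; exists (exist _ (val z) (B1P z)) => //=; exact/set_mem/valP.
exists (CBallType CP), (fun z => exist (fun y => y \in C) _ (kP z)); split => // y z yz /=.
by congr (val (h _)); apply: val_inj.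
Qed.

Definition locally_determined
    (Sim : forall B1 B2 : cballType, set (B1 -> B2)) (S : groupClosed (LS X)) :
    Prop :=
  forall g : LS X, g \in S -> forall x : X, exists (r l : {posnum R})
    (h : mk_cball x r -> mk_cball (g x) (l%:num * r%:num)%:pos),
    [/\ forall y, val (h y) = g (val y),
        surj_similarity l%:num h & Sim _ _ h].

Definition locally_finitely_determined (S : groupClosed (LS X)) : Prop :=
  exists Sim : forall B1 B2 : cballType, set (B1 -> B2),
    finite_similarity_structure Sim /\ locally_determined Sim S.

End FiniteSimilarityStructure.

Record hilbertSpace (R : realType) := HilbertSpace {
  hilbert_space :> completeNormedModType R;
  inner : {dot hilbert_space for idfun};
  inner_norm : forall v : hilbert_space, `|v| ^+ 2 = inner v v }.

(* Weyl's axioms for a nonempty affine space; [asub p q] is the vector from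
   [q] to [p]. *)
Record affineHilbert (R : realType) := AffineHilbert {
  points :> Type;
  direction : hilbertSpace R;
  origin : points;
  asub : points -> points -> direction;
  asubD : forall p q s, asub p q + asub q s = asub p s;
  asub_bij : forall q, bijective (asub^~ q) }.

Definition adist (R : realType) (H : affineHilbert R) (p q : H) : R :=
  `|asub p q|.

Section Haagerup.
Variables (R : realType) (G : groupType).

Definition isometric_action (H : affineHilbert R) (a : G -> H -> H) : Prop :=
  [/\ forall p, a 1%g p = p,
      forall g h p, a (g * h)%g p = a g (a h p) &
      forall g p q, adist (a g p) (a g q) = adist p q].

Definition abounded (H : affineHilbert R) (B : set H) : Prop :=
  exists M : R, forall p q, B p -> B q -> adist p q <= M.

Definition metrically_proper (H : affineHilbert R) (a : G -> H -> H) : Prop :=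
  forall B : set H, abounded B ->
    finite_set [set g | (a g @` B) `&` B !=set0].

(* Countability is part of the notion, which is only defined for countable
   discrete groups. *)
Definition haagerup : Prop :=
  countable [set: G] /\
  exists (H : affineHilbert R) (a : G -> H -> H),
    isometric_action a /\ metrically_proper a.

End Haagerup.

(* Main.v *)
Require Import Defs.
From HB Require Import structures.
From mathcomp Require Import all_boot all_order all_algebra finmap.
From mathcomp Require Import all_classical all_reals all_analysis.
From mathcomp Require Import showcase.summability.
From mathcomp Require Import ring lra.

(** Why the theorem holds. Let [Sim] locally determine the group. Call a closed
    ball [B] good for [g] if [g] restricts on [B] to an element of some
    [Sim B C], and bad otherwise. Good balls cover the compact space [X] and
    sub-balls of good balls are good, so only finitely many balls are bad
    (finite_bad).

    Consider maps from balls to [X] up to precomposition with elements of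
    [Sim]. The group acts on these classes by composition. Let [Z] be the set
    of classes of the inclusions of balls. The translate by [g] of the class of
    [B] lies in [Z] exactly when [B] is good for [g] (ball_class_transport), so
    the symmetric difference of [g Z] and [Z] has one point for each ball that
    is bad for [g] and one for each ball that is bad for the inverse of [g]. In
    particular it is finite, and the group acts by isometries on the affine
    Hilbert space of the functions that differ from the indicator of [Z] by a
    square summable function. The displacement of the indicator itself is the
    square root of the number of points of this symmetric difference; hence the
    action is proper, and the group is countable, provided only finitely many
    [g] have at most [n] bad balls on each side
    (haagerup_of_commensurated_set).

    For such a [g], every point lies in a maximal good ball [B]. The balls
    strictly containing [B] are bad for [g], and those strictly containing
    [g B] are bad for the inverse (maximal_transport), so [B] and [g B] have at
    most [n] balls strictly above them. By compactness there are finitely many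
    balls with this property (finite_shallow), and between two of them [Sim]
    contains finitely many maps. As [g] is determined by its restrictions to
    its maximal good balls, only finitely many [g] are possible
    (finite_local_maps). *)

Set Implicit Arguments.
Unset Strict Implicit.
Unset Printing Implicit Defensive.

Import Order.TTheory GRing.Theory Num.Theory.
Import numFieldNormedType.Exports.

Local Open Scope classical_set_scope.
Local Open Scope ring_scope.

#[local] Existing Instance totally_filter.

(** * Square summable families *)

Section UnorderedSums.
Context {R : realType} {I : choiceType}.
Implicit Types (f g : I -> R) (A B : {fset I}).

(** Partial sums over finite sets, whose limit along the directed set of all
    finite subsets is the unordered sum: the index set below is uncountable in
    general and carries no order. *)
Definition fsum f A : R := \sum_(i <- A) f i.

Definition usum f : R := lim (fsum f @ totally).

Lemma near_totally A (P : {fset I} -> Prop) :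
  (forall B, (A `<=` B)%fset -> P B) -> \forall B \near totally, P B.
Proof. by move=> AP; exists A. Qed.

Lemma fsum_ge0 f A : (forall i, 0 <= f i) -> 0 <= fsum f A.
Proof. by move=> f0; exact: sumr_ge0. Qed.

Lemma fsum_incl f A B : (forall i, 0 <= f i) -> (A `<=` B)%fset ->
  fsum f A <= fsum f B.
Proof.
move=> f0 AB; rewrite /fsum (big_fsetID _ (mem A) B)/=.
rewrite (_ : [fset x in B | x \in A]%fset = A) ?lerDl ?sumr_ge0//.
apply/fsetP => i; rewrite !inE/= andbC.
by case: (boolP (i \in A)) => // /(fsubsetP AB).
Qed.

Lemma fsumD f g : fsum (f \+ g) = fsum f + fsum g.
Proof. by apply/funext => A; exact: big_split. Qed.

Lemma fsumZ k f : fsum (fun i => k * f i) = k *: fsum f.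
Proof. by apply/funext => A; rewrite /fsum -mulr_sumr. Qed.

(** The partial sums are monotone along inclusion, so they converge to their
    supremum. *)
Lemma cvg_fsum_bounded f (M : R) : (forall i, 0 <= f i) ->
  (forall A, fsum f A <= M) -> cvg (fsum f @ totally).
Proof.
move=> f0 fM; have hs : has_sup (range (fsum f)).
  by split; [exists (fsum f fset0), fset0|exists M => _ [A _ <-]].
apply/cvg_ex; exists (sup (range (fsum f))).
apply/cvgrPdist_le => e e0.
have [_ [A _ <-] Ae] := sup_adherent e0 hs.
apply: (@near_totally A) => B AB.
rewrite ger0_norm ?subr_ge0; last by apply: sup_upper_bound => //; exists B.
rewrite lerBlDr addrC -lerBlDr (le_trans (ltW Ae))//.
exact: fsum_incl.
Qed.

Lemma cvg_fsumD f g : cvg (fsum f @ totally) -> cvg (fsum g @ totally) ->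
  cvg (fsum (f \+ g) @ totally).
Proof. by move=> cf cg; rewrite fsumD; exact: is_cvgD. Qed.

Lemma usumD f g : cvg (fsum f @ totally) -> cvg (fsum g @ totally) ->
  usum (f \+ g) = usum f + usum g.
Proof. by move=> cf cg; rewrite /usum fsumD; exact: limD. Qed.

Lemma cvg_fsumZ k f : cvg (fsum f @ totally) ->
  cvg (fsum (fun i => k * f i) @ totally).
Proof. by move=> cf; rewrite fsumZ; exact: is_cvgZr. Qed.

Lemma usumZ k f : cvg (fsum f @ totally) ->
  usum (fun i => k * f i) = k * usum f.
Proof. by move=> cf; rewrite /usum fsumZ; exact: limZr. Qed.

Lemma fsum_le_usum f A : (forall i, 0 <= f i) -> cvg (fsum f @ totally) ->
  fsum f A <= usum f.
Proof.
move=> f0 cf; apply: limr_ge => //.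
by apply: (@near_totally A) => B; exact: fsum_incl.
Qed.

Lemma usum_le f (M : R) : cvg (fsum f @ totally) ->
  (forall A, fsum f A <= M) -> usum f <= M.
Proof.
move=> cf fM; apply: limr_le => //.
by apply: (@near_totally fset0) => B _.
Qed.

End UnorderedSums.

Section SquareSummable.
Context {R : realType} {I : choiceType}.
Implicit Types (f g : I -> R).

Definition sqsummable f : bool :=
  `[< exists M : R, forall A : {fset I}, fsum (fun i => f i ^+ 2) A <= M >].

Lemma sqsummableP f :
  sqsummable f <-> cvg (fsum (fun i => f i ^+ 2) @ totally).
Proof.
have f0 i : 0 <= f i ^+ 2 by exact: sqr_ge0.
split=> [/asboolP[M fM]|cf]; first exact: cvg_fsum_bounded fM.
by apply/asboolP; exists (usum (fun i => f i ^+ 2)) => A; exact: fsum_le_usum.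
Qed.

(** Sums stay square summable by
    [(a x + y)^2 <= 2 a^2 x^2 + 2 y^2]. *)
Lemma sqsummable_submod : submod_closed sqsummable.
Proof.
split.
  apply/asboolP; exists 0 => A; rewrite /fsum big1// => i _.
  by rewrite expr0n.
move=> a f g /asboolP[M fM] /asboolP[N gN]; apply/asboolP.
exists (2 * a ^+ 2 * M + 2 * N) => A.
apply: (@le_trans _ _ (2 * a ^+ 2 * fsum (fun i => f i ^+ 2) A +
   2 * fsum (fun i => g i ^+ 2) A)); last first.
  by rewrite lerD// ler_wpM2l// mulr_ge0// sqr_ge0.
rewrite /fsum !mulr_sumr -big_split/=; apply: ler_sum => i _.
rewrite -[(a *: f + g) i]/(a * f i + g i).
by have := sqr_ge0 (a * f i - g i); lra.
Qed.

(** Polarization: [f g = ((f + g)^2 - f^2 - g^2) / 2] is a combination of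
    families whose terms are nonnegative and whose partial sums are bounded. *)
Lemma cvg_fsumM f g : sqsummable f -> sqsummable g ->
  cvg (fsum (fun i => f i * g i) @ totally).
Proof.
move=> sf sg; have sfg : sqsummable (f + g).
  by rewrite -[f]scale1r; exact: sqsummable_submod.2.
move: sf sg sfg => /sqsummableP cf /sqsummableP cg /sqsummableP cfg.
have := cvg_fsumZ (k := 2^-1)
  (cvg_fsumD (cvg_fsumD cfg (cvg_fsumZ (k := -1) cf)) (cvg_fsumZ (k := -1) cg)).
suff -> : (fun i => f i * g i) = fun i => 2^-1 *
  (((fun i => (f + g) i ^+ 2) \+ (fun i => -1 * f i ^+ 2)) i +
   -1 * g i ^+ 2) by [].
by apply/funext => i /=; rewrite -[(f + g) i]/(f i + g i); field.
Qed.

HB.instance Definition _ :=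
  GRing.isSubmodClosed.Build _ _ sqsummable sqsummable_submod.

Lemma sqsummableB f g : sqsummable f -> sqsummable g -> sqsummable (f - g).
Proof. by move=> sf sg; suff : f - g \in sqsummable by []; exact: rpredB. Qed.

Lemma sqsummableD f g : sqsummable f -> sqsummable g -> sqsummable (f + g).
Proof. by move=> sf sg; suff : f + g \in sqsummable by []; exact: rpredD. Qed.

End SquareSummable.

Section Ell2.
Context {R : realType} {I : choiceType}.

Record ell2 := Ell2 { ell2_fun :> I -> R; ell2P : sqsummable ell2_fun }.

HB.instance Definition _ := [isSub for ell2_fun].
HB.instance Definition _ := [Choice of ell2 by <:].
HB.instance Definition _ := [SubChoice_isSubLmodule of ell2 by <:].

Implicit Types (u v w : ell2).

Lemma ell2_linE a u v i : (a *: u + v) i = a * u i + v i.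
Proof. by []. Qed.

Definition ell2_dot u v : R := usum (fun i => u i * v i).

Lemma ell2_dotC u v : ell2_dot u v = ell2_dot v u.
Proof. by congr usum; apply/funext => i; rewrite mulrC. Qed.

Lemma ell2_dotPl a u v w :
  ell2_dot (a *: u + v) w = a * ell2_dot u w + ell2_dot v w.
Proof.
have cM x y := cvg_fsumM (ell2P x) (ell2P y).
rewrite /ell2_dot -usumZ// -usumD//; last exact: cvg_fsumZ.
by congr usum; apply/funext => i; rewrite ell2_linE mulrDl -mulrA.
Qed.

Lemma ell2_dot_bilinear : bilinear_for *%R (idfun \; *%R) ell2_dot.
Proof.
split=> w a u v; first exact: ell2_dotPl.
by rewrite ell2_dotC ell2_dotPl !(ell2_dotC w).
Qed.

Lemma fsum_le_dot u (A : {fset I}) :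
  fsum (fun i => u i ^+ 2) A <= ell2_dot u u.
Proof.
rewrite /ell2_dot; under [X in usum X]eq_fun do rewrite -expr2.
by apply: fsum_le_usum; [move=> i; exact: sqr_ge0|exact/sqsummableP/ell2P].
Qed.

Lemma ell2_dot_le u M :
  (forall A, fsum (fun i => u i ^+ 2) A <= M) -> ell2_dot u u <= M.
Proof.
move=> uM; apply: usum_le; first exact: cvg_fsumM (ell2P u) (ell2P u).
by move=> A; under [X in fsum X]eq_fun do rewrite -expr2; exact: uM.
Qed.

Lemma sqr_le_dot u i : u i ^+ 2 <= ell2_dot u u.
Proof. by have := fsum_le_dot u [fset i]%fset; rewrite /fsum big_seq_fset1. Qed.

Lemma ell2_dot_ge0 u : 0 <= ell2_dot u u.
Proof.
apply: le_trans (fsum_le_dot u fset0).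
by rewrite fsum_ge0// => i; exact: sqr_ge0.
Qed.

Lemma ell2_dot_eq0 u : ell2_dot u u = 0 -> u = 0.
Proof.
move=> u0; apply/val_inj/funext => i; apply/eqP.
by rewrite -sqrf_eq0 eq_le sqr_ge0 andbT -u0 sqr_le_dot.
Qed.

Lemma ell2_dot_gt0 u : u != 0 -> 0 < ell2_dot u u.
Proof.
move=> u0; rewrite lt_neqAle ell2_dot_ge0 andbT eq_sym.
by apply: contra_neq u0; exact: ell2_dot_eq0.
Qed.

HB.instance Definition _ :=
  @bilinear_isBilinear.Build R ell2 ell2 R _ _ ell2_dot ell2_dot_bilinear.

Lemma ell2_dot_hermitian u v :
  ell2_dot u v = (-1) ^+ false * idfun (ell2_dot v u).
Proof. by rewrite mul1r ell2_dotC. Qed.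

HB.instance Definition _ := @isHermitianSesquilinear.Build
  R ell2 false idfun ell2_dot ell2_dot_hermitian.
HB.instance Definition _ := @isDotProduct.Build R ell2 ell2_dot ell2_dot_gt0.

Definition ell2_norm u : R := Num.sqrt (ell2_dot u u).

Lemma sqr_ell2_norm u : ell2_norm u ^+ 2 = ell2_dot u u.
Proof. by rewrite sqr_sqrtr// ell2_dot_ge0. Qed.

Lemma ell2_norm_eq0 u : ell2_norm u = 0 -> u = 0.
Proof. by move=> u0; apply: ell2_dot_eq0; rewrite -sqr_ell2_norm u0 expr0n. Qed.

Lemma ell2_dot_lin a b u v :
  ell2_dot (a *: u + b *: v) (a *: u + b *: v) =
  a ^+ 2 * ell2_dot u u + 2 * a * b * ell2_dot u v + b ^+ 2 * ell2_dot v v.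
Proof.
(* The right-hand side is hidden from the rewriting: its products would match
   the linearity rules as well. *)
set r := (X in _ = X).
rewrite !(linearDl, linearDr) !(linearZl_LR, linearZr) /= (ell2_dotC v u).
by rewrite /r; ring.
Qed.

(** Cauchy-Schwarz, from the positivity of the square of [|v| u - |u| v]. *)
Lemma ell2_dot_le_norm u v : ell2_dot u v <= ell2_norm u * ell2_norm v.
Proof.
set s := ell2_norm u; set t := ell2_norm v.
have [/eqP s0|s0] := boolP (s == 0).
  by rewrite s0 mul0r (ell2_norm_eq0 s0) linear0l.
have [/eqP t0|t0] := boolP (t == 0).
  by rewrite t0 mulr0 (ell2_norm_eq0 t0) linear0r.
have st0 : 0 < s * t by rewrite mulr_gt0// lt_neqAle eq_sym ?s0 ?t0 sqrtr_ge0.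
have := ell2_dot_ge0 (t *: u + (- s) *: v).
rewrite ell2_dot_lin -!sqr_ell2_norm -/s -/t => h.
rewrite -(ler_pM2l st0); lra.
Qed.

Lemma ell2_normD u v : ell2_norm (u + v) <= ell2_norm u + ell2_norm v.
Proof.
rewrite -(@ler_pXn2r _ 2)// ?nnegrE ?addr_ge0 ?sqrtr_ge0// sqr_ell2_norm.
rewrite -[u]scale1r -[v]scale1r ell2_dot_lin !scale1r -!sqr_ell2_norm.
by have := ell2_dot_le_norm u v; lra.
Qed.

Lemma ell2_normZ (k : R) u : ell2_norm (k *: u) = `|k| * ell2_norm u.
Proof.
rewrite /ell2_norm -[k *: u]addr0 -[0](scale0r u) ell2_dot_lin.
by rewrite mulr0 mul0r expr0n/= mul0r !addr0 sqrtrM ?sqr_ge0// sqrtr_sqr.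
Qed.

HB.instance Definition _ := @Lmodule_isNormed.Build
  R ell2 ell2_norm ell2_normD ell2_normZ ell2_norm_eq0.

Lemma ell2_normE u : `|u| ^+ 2 = ell2_dot u u.
Proof. exact: sqr_ell2_norm. Qed.

Lemma ell2_norm_le u (e : R) : 0 <= e ->
  (forall A, fsum (fun i => u i ^+ 2) A <= e ^+ 2) -> `|u| <= e.
Proof.
move=> e0 /ell2_dot_le ue; rewrite -(@ler_pXn2r _ 2)// ?nnegrE//.
by rewrite ell2_normE.
Qed.

Lemma fsum_le_norm u A : fsum (fun i => u i ^+ 2) A <= `|u| ^+ 2.
Proof. by rewrite ell2_normE fsum_le_dot. Qed.

Lemma ell2_coord_le u i : `|u i| <= `|u|.
Proof.
rewrite -(@ler_pXn2r _ 2)// ?nnegrE//.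
by rewrite ell2_normE real_normK ?num_real// sqr_le_dot.
Qed.

Lemma cvg_fsum_dist (T : Type) (F : set_system T) (FF : Filter F)
    (f : T -> I -> R) (g h : I -> R) A :
  (forall i, f t i @[t --> F] --> g i) ->
  fsum (fun i => (h i - f t i) ^+ 2) A @[t --> F] -->
  fsum (fun i => (h i - g i) ^+ 2) A.
Proof.
move=> fg; rewrite /fsum; elim: (enum_fset A) => [|i s IH].
  by rewrite big_nil; under eq_fun do rewrite big_nil; exact: cvg_cst.
rewrite big_cons; under eq_fun do rewrite big_cons.
apply: cvgD => //; rewrite expr2; under eq_fun do rewrite expr2.
by apply: cvgM; apply: cvgB => //; exact: cvg_cst.
Qed.

(** A Cauchy filter converges coordinatewise. The Cauchy estimate bounds each
    finite partial sum of squares, hence passes to the coordinatewise limit;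
    this shows both that the limit is square summable and that the filter
    converges to it in norm. *)
Lemma ell2_complete (F : set_system ell2) : ProperFilter F -> cauchy F -> cvg F.
Proof.
move=> FF /cauchy_ballP Fc.
have Fi i : cvg ((u : ell2) i @[u --> F]).
  apply: cauchy_cvg; apply/cauchy_ballP => e e0.
  rewrite near_map2; apply: filterS (Fc _ e0) => -[u v].
  rewrite -!ball_normE /= => uv.
  exact: le_lt_trans (ell2_coord_le (u - v) i) uv.
pose phi i : R := lim ((u : ell2) i @[u --> F]).
have close e : 0 < e -> \forall u \near F,
    forall A, fsum (fun i => ((u : ell2) i - phi i) ^+ 2) A <= e ^+ 2.
  move=> e0; apply: filterS (nearP_dep (Fc _ e0)) => u uF A.
  apply: (cvgr_to_le (cvg_fsum_dist (h := u) (A := A) FF Fi)).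
  apply: filterS uF => v; rewrite -ball_normE /= => uv.
  apply: le_trans (fsum_le_norm (u - v) A) _.
  by rewrite ler_pXn2r ?nnegrE// ltW.
have phiP : sqsummable phi.
  have [u uP] := filter_ex (close 1 ltr01).
  have -> : phi = (u : I -> R) - (fun i => u i - phi i).
    by apply/funext => i; rewrite fctE opprB addrC subrK.
  apply: sqsummableB; first exact: ell2P.
  by apply/asboolP; exists (1 ^+ 2).
apply/cvg_ex; exists (Ell2 phiP); apply/cvgrPdist_le => e e0.
apply: filterS (close e e0) => u ue; rewrite distrC.
by apply: ell2_norm_le; [exact: ltW|].
Qed.

HB.instance Definition _ := Uniform_isComplete.Build ell2 ell2_complete.

Definition ell2_hilbert : hilbertSpace R :=
  @HilbertSpace R ell2 ell2_dot sqr_ell2_norm.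

End Ell2.

Arguments ell2 : clear implicits.
Arguments ell2_hilbert : clear implicits.

(** * Isometric actions from commensurated subsets *)

Section AffineDistance.
Context {R : realType}.

Lemma adistC (H : affineHilbert R) (p q : H) : adist p q = adist q p.
Proof.
rewrite /adist; have := asubD p q p.
have -> : asub p p = 0 by apply: (addrI (asub p p)); rewrite asubD addr0.
by move=> /eqP; rewrite addr_eq0 => /eqP ->; rewrite normrN.
Qed.

Lemma adist_triangle (H : affineHilbert R) (p q s : H) :
  adist p s <= adist p q + adist q s.
Proof. by rewrite /adist -(asubD p q s); exact: ler_normD. Qed.

End AffineDistance.

Section ProperAction.
Context {R : realType} {G : groupType} {E : choiceType}.
Variables (act : G -> E -> E) (Z : set E).
Hypothesis act1 : forall e, act 1%g e = e.
Hypothesis actM : forall g h e, act (g * h)%g e = act g (act h e).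
Local Notation moved g := ((act g @` Z) `+` Z).

Hypothesis finite_moved : forall g, finite_set (moved g).
Hypothesis finite_bounded_moved : forall n : nat,
  finite_set [set g | (#|` fset_set (moved g)| <= n)%N].

Lemma actK g : cancel (act g) (act g^-1%g).
Proof. by move=> e; rewrite -actM mulVg act1. Qed.

Lemma actVK g : cancel (act g^-1%g) (act g).
Proof. by move=> e; rewrite -actM mulgV act1. Qed.

Definition translate g (f : E -> R) : E -> R := f \o act g^-1%g.

Lemma fsum_translate g f (A : {fset E}) :
  fsum (translate g f) A = fsum f (act g^-1%g @` A)%fset.
Proof.
rewrite /fsum big_imfset//= => x y _ _ xy.
exact: (can_inj (actVK g)).
Qed.

Lemma sqsummable_translate g f : sqsummable f -> sqsummable (translate g f).
Proof.
move=> /asboolP[M fM]; apply/asboolP; exists M => A.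
by rewrite (fsum_translate g (fun e => f e ^+ 2)); exact: fM.
Qed.

Lemma image_act g e : (act g @` Z) e = Z (act g^-1%g e).
Proof.
apply/propext; split => [[z Zz <-]|Ze]; first by rewrite actK.
by exists (act g^-1%g e) => //; rewrite actVK.
Qed.

Lemma sqr_translate_indic g e :
  (translate g \1_Z e - \1_Z e) ^+ 2 =
  (e \in fset_set (moved g))%:R :> R.
Proof.
rewrite in_fset_set// in_setU !in_setD -/(setY _ _) /translate /= !indicE.
have -> : (e \in act g @` Z) = (act g^-1%g e \in Z).
  by apply/idP/idP; rewrite !in_setE image_act.
by do 2 case: (_ \in _); rewrite /= ?subrr ?subr0 ?sub0r ?sqrrN ?expr1n ?expr0n.
Qed.

Lemma fsum_movedE g :
  fsum (fun e => (translate g \1_Z e - \1_Z e) ^+ 2)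
    (fset_set (moved g)) =
  #|` fset_set (moved g)|%:R :> R.
Proof.
rewrite /fsum card_fset_sum1 natr_sum; apply: eq_big_seq => e eD.
by rewrite sqr_translate_indic eD.
Qed.

Lemma fsum_moved g (A : {fset E}) :
  fsum (fun e => (translate g \1_Z e - \1_Z e) ^+ 2) A <=
  #|` fset_set (moved g)|%:R :> R.
Proof.
rewrite -fsum_movedE; set D := fset_set _.
apply: (@le_trans _ _ (fsum (fun e => (translate g \1_Z e - \1_Z e) ^+ 2)
  (A `|` D)%fset)).
  by apply: fsum_incl (fsubsetUl _ _) => e; exact: sqr_ge0.
rewrite /fsum -(@big_fset_incl _ _ _ _ D (A `|` D)%fset) ?fsubsetUr//.
by move=> e _ eD; rewrite sqr_translate_indic (negbTE eD).
Qed.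

(** The affine space of the action: functions at finite distance from the
    indicator of [Z], so that translation of functions, which is linear on all
    of [E -> R], acts on it by affine maps. *)
Record near_indic := NearIndic {
  near_indic_fun :> E -> R;
  near_indicP : sqsummable (near_indic_fun - \1_Z) }.

Lemma near_indic_sub_subproof (p q : near_indic) :
  sqsummable ((p : E -> R) - (q : E -> R)).
Proof.
rewrite -(subrKA \1_Z) -[X in sqsummable (_ + X)]opprB.
exact: sqsummableB (near_indicP p) (near_indicP q).
Qed.

Definition near_indic_sub (p q : near_indic) : ell2_hilbert R E :=
  Ell2 (near_indic_sub_subproof p q).

Lemma near_indic_inj (p q : near_indic) :
  near_indic_fun p = near_indic_fun q -> p = q.
Proof.
case: p q => [f fP] [g gP] /= fg; move: fP gP; rewrite fg => fP gP.
by congr NearIndic; exact: bool_irrelevance.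
Qed.

Lemma near_indic_subD p q s :
  near_indic_sub p q + near_indic_sub q s = near_indic_sub p s.
Proof. by apply: val_inj; rewrite /= subrKA. Qed.

Lemma near_indic_add_subproof (q : near_indic) (v : ell2_hilbert R E) :
  sqsummable ((q : E -> R) + (v : E -> R) - \1_Z).
Proof. by rewrite addrAC; apply: sqsummableD (near_indicP q) (ell2P v). Qed.

Lemma near_indic_sub_bij q : bijective (near_indic_sub^~ q).
Proof.
exists (fun v => NearIndic (near_indic_add_subproof q v)) => [p|v].
  by apply: near_indic_inj; rewrite /= addrC subrK.
by apply: val_inj; rewrite /= addrC addKr.
Qed.

Lemma indic_subproof : sqsummable (\1_Z - \1_Z : E -> R).
Proof.
by rewrite subrr; suff : (0 : E -> R) \in sqsummable by []; exact: rpred0.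
Qed.

Definition near_indic_space : affineHilbert R :=
  AffineHilbert (NearIndic indic_subproof) near_indic_subD near_indic_sub_bij.

(** [g f - 1_Z = g (f - 1_Z) + (g 1_Z - 1_Z)], where the second term is
    supported on the finite set of points moved by [g]. *)
Lemma translate_subproof g (p : near_indic) :
  sqsummable (translate g p - \1_Z).
Proof.
rewrite -(subrKA (translate g \1_Z)); apply: sqsummableD.
  exact: sqsummable_translate (near_indicP p).
apply/asboolP; exists (#|` fset_set (moved g)|%:R) => A.
exact: fsum_moved.
Qed.

Definition near_indic_act g (p : near_indic_space) : near_indic_space :=
  NearIndic (translate_subproof g p).

Lemma near_indic_act1 p : near_indic_act 1%g p = p.
Proof.
by apply/near_indic_inj/funext => e; rewrite /= /translate /= invg1 act1.
Qed.

Lemma near_indic_actM g h p :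
  near_indic_act (g * h)%g p = near_indic_act g (near_indic_act h p).
Proof.
by apply/near_indic_inj/funext => e; rewrite /= /translate /= invgM actM.
Qed.

Lemma near_indic_act_le g p q :
  adist (near_indic_act g p) (near_indic_act g q) <= adist p q.
Proof.
apply: ell2_norm_le => [|A]; first exact: normr_ge0.
apply: le_trans (fsum_le_norm (near_indic_sub p q) (act g^-1%g @` A)%fset).
by rewrite -fsum_translate.
Qed.

Lemma near_indic_act_isometric : isometric_action near_indic_act.
Proof.
split; [exact: near_indic_act1|exact: near_indic_actM|move=> g p q].
apply/eqP; rewrite eq_le near_indic_act_le/=.
by rewrite -{1}(near_indic_act1 p) -{1}(near_indic_act1 q) -(mulVg g)
  !near_indic_actM near_indic_act_le.
Qed.

(** The displacement of the origin [1_Z] is the square root of the number of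
    moved points. *)
Lemma moved_le g :
  #|` fset_set (moved g)|%:R <=
  adist (near_indic_act g (origin near_indic_space))
    (origin near_indic_space) ^+ 2.
Proof.
rewrite -fsum_movedE; set o := origin _.
exact: (fsum_le_norm (near_indic_sub (near_indic_act g o) o)).
Qed.

(** If [g B] meets [B], then [g] displaces the origin by an amount controlled
    by the diameter of [B] and its distance to the origin; so [g] moves a
    bounded number of points of [E]. *)
Lemma near_indic_act_proper : metrically_proper near_indic_act.
Proof.
move=> B [M BM]; set o := origin near_indic_space.
have [[p0 Bp0]|B0] := pselect (exists p0, B p0); last first.
  by apply: sub_finite_set (finite_set0 _) => g [p [_ Bp]]; apply: B0; exists p.
have M0 : 0 <= M by apply: le_trans (BM _ _ Bp0 Bp0); exact: normr_ge0.
have C0 : 0 <= M + M + adist p0 o *+ 2.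
  by apply: addr_ge0; [exact: addr_ge0|apply: mulrn_wge0; exact: normr_ge0].
have := archi_boundP (exprn_ge0 2 C0); set n := Num.bound _ => /ltW nM.
apply: sub_finite_set (finite_bounded_moved n) => g [_ [[p Bp <-] Bgp]] /=.
rewrite -(ler_nat R); apply: le_trans (moved_le g) (le_trans _ nM).
rewrite ler_pXn2r ?nnegrE//; last exact: normr_ge0.
have := adist_triangle (near_indic_act g o) (near_indic_act g p0) o.
have := adist_triangle (near_indic_act g p0) (near_indic_act g p) o.
have := adist_triangle (near_indic_act g p) p0 o.
have := near_indic_act_le g o p0; have := near_indic_act_le g p0 p.
have := BM _ _ Bp0 Bp; have := BM _ _ Bgp Bp0.
rewrite (adistC o p0); lra.
Qed.

(** Properness of the affine action rests on the finiteness of the sets of [g]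
    that move at most [n] points, and countability on the fact that [G] is the
    union of these finite sets over [n]. *)
Lemma haagerup_of_commensurated_set : haagerup R G.
Proof.
split; last first.
  exists near_indic_space, near_indic_act.
  split; [exact: near_indic_act_isometric|exact: near_indic_act_proper].
rewrite (_ : setT =
    \bigcup_n [set g | (#|` fset_set (moved g)| <= n)%N]).
  by apply: bigcup_countable => // n _; exact: finite_set_countable.
apply/esym; rewrite -subTset => g _.
by exists #|` fset_set (moved g)| => //=; exact: leqnn.
Qed.

End ProperAction.

(** * Balls of a compact ultrametric space *)

Lemma finite_subsets (T : choiceType) (A : set T) :
  finite_set A -> finite_set [set B : set T | B `<=` A].
Proof.
move=> /finite_fsetP[X ->].
apply: sub_finite_set
  (finite_image (fun Y : {fset T} => [set` Y]) (finite_fset (fpowerset X))).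
move=> B BX; have Bfin : finite_set B by exact: sub_finite_set (finite_fset X).
exists (fset_set B) => /=; last exact: fset_setK.
rewrite fpowersetE; apply/fsubsetP => x.
by rewrite in_fset_set// in_setE; exact: BX.
Qed.

Lemma finite_set_encode (T : Type) (U : choiceType) (K : set T) (A : set U)
    (code : T -> set U) :
  finite_set A -> (forall x, K x -> code x `<=` A) ->
  {in K &, injective code} -> finite_set K.
Proof.
move=> Afin codeA code_inj; rewrite -(eq_finite_set (inj_card_eq code_inj)).
by apply: sub_finite_set (finite_subsets Afin) => _ [x Kx <-]; exact: codeA.
Qed.

(** Covering compactness for a space that need not have a distinguished
    point. *)
Lemma compact_finite_cover (T : topologicalType) (J : choiceType)
    (D : set J) (f : J -> set T) :
  compact [set: T] -> (forall i, D i -> open (f i)) ->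
  (forall x, exists2 i, D i & f i x) ->
  exists2 D' : set J, finite_set D' /\ D' `<=` D &
    forall x, exists2 i, D' i & f i x.
Proof.
move=> cT fo fD; have [[x0 _]|T0] := pselect (exists x : T, True); last first.
  by exists set0 => [|x]; [split => //; exact: finite_set0|case: T0; exists x].
pose pT : ptopologicalType := HB.pack T (isPointed.Build T x0).
have : @cover_compact pT [set: T] by rewrite -compact_cover.
move=> /(_ J D f fo)[x _|D' D'D cD']; first by have [i] := fD x; exists i.
exists [set` D'] => [|x].
  by split; [exact: finite_fset|move=> i /D'D/set_mem].
by have [i] := cD' x I; exists i.
Qed.

Section Balls.
Context {R : realType} {X : metricType R}.
Hypothesis Xu : ultrametric X.

HB.instance Definition _ := gen_eqMixin (@cballType R X).
HB.instance Definition _ := gen_choiceMixin (@cballType R X).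
Implicit Types (B C D : @cballType R X) (x y : X).

Lemma cball_inj B C : cball_set B = cball_set C -> B = C.
Proof.
case: B C => [B BP] [C CP] /= BC; move: BP CP; rewrite BC => BP CP.
by congr CBallType; exact: Prop_irrelevance.
Qed.

(** Every point of an ultrametric ball is a centre of it. *)
Lemma cballP B y : cball_set B y ->
  exists2 r : R, 0 < r & forall z, cball_set B z = (mdist y z <= r).
Proof.
have [x [r [r0 ->]]] := cball_setP B; rewrite /cball/= => xy.
exists r => // z; apply/propext; split => [xz|yz].
  by apply: le_trans (Xu y z x) _; rewrite ge_max metric_sym xy.
by apply: le_trans (Xu x z y) _; rewrite ge_max xy.
Qed.

Lemma cball_neq0 B : exists x, cball_set B x.
Proof.
by have [x [r [r0 ->]]] := cball_setP B; exists x; rewrite /cball/= mdistxx ltW.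
Qed.

Lemma cball_open B : open (B : set X).
Proof.
rewrite openE => x Bx; have [r r0 BE] := cballP Bx.
apply/nbhs_ballP; exists r => // y; rewrite ballEmdist /= BE; exact: ltW.
Qed.

Lemma cball_comparable B C x : cball_set B x -> cball_set C x ->
  B `<=` C \/ C `<=` B.
Proof.
move=> /cballP[r r0 BE] /cballP[s s0 CE].
have [rs|sr] := leP r s; [left|right] => y; rewrite BE CE.
  by move/le_trans; apply.
by move/le_trans; apply; exact: ltW.
Qed.

Lemma mk_cballE x (r : {posnum R}) y :
  cball_set (mk_cball x r) y = (mdist x y <= r%:num).
Proof. by []. Qed.

Lemma mk_cball_center x (r : {posnum R}) : cball_set (mk_cball x r) x.
Proof. by rewrite mk_cballE mdistxx. Qed.

(** In an ultrametric space the balls containing [B] form a chain, so having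
    at least [n] of them strictly above [B] is expressed by an increasing
    chain, which suits inductions better than a cardinal. *)
Fixpoint deep n B : Prop :=
  if n is m.+1 then exists2 C : cballType, B `<` C & deep m C else True.

Lemma proper_cball_neq B C : B `<=` C -> B <> C -> B `<` C.
Proof.
by move=> BC nBC; split => // CB; apply: nBC; apply/cball_inj/seteqP.
Qed.

Lemma deep_chain n B : deep n B ->
  exists s : seq cballType,
    [/\ uniq s, size s = n & forall C : cballType, C \in s -> B `<` C].
Proof.
elim: n B => [|n IH] B /=; first by exists [::].
move=> [C BC /IH[s [us ss Cs]]]; exists (C :: s); split => /=.
- by rewrite us andbT; apply/negP => /Cs[].
- by rewrite ss.
- move=> D; rewrite in_cons => /orP[/eqP -> //|/Cs[CD nDC]].
  split; first exact: subset_trans BC.1 CD.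
  by move=> DB; apply: nDC; exact: subset_trans DB BC.1.
Qed.

(** The balls above [B] are counted through a labelling [f], because they will
    be detected by the points of another set that they give rise to. *)
Lemma deep_card n B (T : choiceType) (f : cballType -> T) (K : set T) :
  finite_set K -> injective f ->
  (forall C : cballType, B `<` C -> K (f C)) -> deep n B ->
  (n <= #|` fset_set K|)%N.
Proof.
move=> Kfin f_inj BK /deep_chain[s [us <- sB]].
rewrite -(size_map f); apply: uniq_leq_size; first by rewrite map_inj_uniq.
move=> _ /mapP[C /sB/BK KC ->].
by rewrite in_fset_set//; exact/mem_set.
Qed.

Hypothesis Xc : compact [set: X].

(** The source of all finiteness of balls. Extract a finite cover from [P]: a
    ball that is not strictly inside a member of the cover is the union of the
    members that it contains. *)
Lemma finite_not_inside (P : set cballType) :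
  (forall x, exists2 D, P D & cball_set D x) ->
  finite_set
    [set B : cballType | forall D : cballType, P D -> B `<=` D -> B = D].
Proof.
move=> Pcov.
have [Q [Qfin QP] Qcov] :=
  compact_finite_cover Xc (fun B _ => cball_open B) Pcov.
apply: (@finite_set_encode _ _ _ Q
  (fun B : cballType => [set D : cballType | Q D /\ D `<=` B])) => //.
  by move=> B _ D [].
have sub B C : (forall D : cballType, P D -> B `<=` D -> B = D) ->
    [set D : cballType | Q D /\ D `<=` B] =
    [set D : cballType | Q D /\ D `<=` C] -> B `<=` C.
  move=> BP BC x Bx; have [D QD Dx] := Qcov x.
  suff : [set D : cballType | Q D /\ D `<=` B] D by rewrite BC => -[_]; exact.
  split => //; have [BD|//] := cball_comparable Bx Dx.
  by rewrite -(BP D) //; exact: QP.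
move=> B C; rewrite !in_setE => BP CP BC.
by apply/cball_inj/seteqP; split; exact: sub.
Qed.

(** [B] and the balls disjoint from [B] cover [X], and no ball containing
    [B] is strictly inside one of them. *)
Lemma finite_supersets B : finite_set [set C : cballType | B `<=` C].
Proof.
pose P := [set D : cballType | D = B \/ cball_set D `&` B = set0].
apply: sub_finite_set (@finite_not_inside P _); last first.
  move=> x; have [Bx|nBx] := pselect (cball_set B x).
    by exists B => //; left.
  have [b Bb] := cball_neq0 B; have [r r0 BE] := cballP Bb.
  exists (mk_cball x (PosNum r0)); last exact: mk_cball_center.
  right; apply/seteqP; split => // z [/= xz Bz].
  apply: nBx; move: Bz; rewrite !BE => bz.
  by apply: le_trans (Xu b x z) _; rewrite ge_max bz metric_sym.
move=> C BC D [->|DB] CD; first by apply/cball_inj/seteqP.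
have [b Bb] := cball_neq0 B.
by have : set0 b by rewrite -DB; split => //; exact/CD/BC.
Qed.

(** The tree of balls is locally finite. The balls all of whose strict
    sub-balls are deep cover [X]: around a limit point there are balls as deep
    as desired, and an isolated point is itself a ball with no strict
    sub-ball. *)
Lemma finite_shallow n : finite_set [set B : cballType | ~ deep n B].
Proof.
pose P := [set D : cballType | forall B : cballType, B `<` D -> deep n B].
apply: sub_finite_set (@finite_not_inside P _); last first.
  move=> x.
  have [[D Dx]|xlim] := pselect (exists D : cballType, cball_set D = [set x]).
    exists D; last by rewrite Dx.
    move=> B []; rewrite Dx => Bx; have [b Bb] := cball_neq0 B.
    by case=> _ ->; rewrite -(Bx _ Bb).
  have deepx k : exists2 D, deep k D & cball_set D x.
    elim: k => [|k [D dD Dx]].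
      by exists (mk_cball x 1%:pos) => //; exact: mk_cball_center.
    have [y Dy yx] : exists2 y, cball_set D y & y <> x.
      apply: contra_notP xlim => noy; exists D.
      apply/seteqP; split => [y Dy|_ -> //].
      by apply: contra_notP noy; exists y.
    have d0 : 0 < mdist x y / 2.
      by rewrite divr_gt0// mdist_gt0; apply/eqP/nesym.
    exists (mk_cball x (PosNum d0)); last exact: mk_cball_center.
    exists D => //; split => [z|/(_ _ Dy)]; rewrite mk_cballE /=.
      have [r r0 DE] := cballP Dx; move: Dy; rewrite !DE => xyr xz.
      by apply: le_trans xz _; have := mdist_ge0 x y; lra.
    by have := d0; lra.
  case: n @P => [|m] P.
    by exists (mk_cball x 1%:pos) => //; exact: mk_cball_center.
  by have [D dD Dx] := deepx m; exists D => // B BD; exists D.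
move=> B /= dB D PD BD; apply: contra_notP dB => BD'; apply: PD.
exact: proper_cball_neq.
Qed.

Lemma exists_maximal (P : set cballType) B : P B ->
  exists C : cballType,
    [/\ P C, B `<=` C & forall D : cballType, P D -> C `<=` D -> D = C].
Proof.
move=> PB.
have [n] : exists n, ~ deep n B.
  exists #|` fset_set [set C : cballType | B `<=` C]|.+1.
  move/(deep_card (f := id) (finite_supersets B) (fun _ _ => id)
    (fun C BC => BC.1)).
  by rewrite ltnn.
elim: n B PB => [B _ []//|n IH B PB ndB].
have [[C [PC BC nBC]]|noC] :=
  pselect (exists C : cballType, [/\ P C, B `<=` C & B <> C]).
  have [|D [PD CD Dmax]] := IH C PC.
    by apply: contra_not ndB => dC; exists C => //; exact: proper_cball_neq.
  by exists D; split => //; exact: subset_trans CD.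
exists B; split => // D PD BD; apply: contra_notP noC => DB.
by exists D; split => //; exact/nesym.
Qed.

End Balls.

(** * Balls transported by a local similarity *)

Section Transport.
Context {R : realType} {X : metricType R}.
Hypothesis Xu : ultrametric X.
Variable Sim : forall B1 B2 : @cballType R X, set (B1 -> B2).
Hypothesis SimP : finite_similarity_structure Sim.
Implicit Types (B C D : @cballType R X) (x : X) (f g : X -> X).

(** Elements of [Sim B C] are onto, so this forces [C] to be the image of [B]
    under [g]. *)
Definition transports g B C : Prop :=
  exists2 h : B -> C, Sim h & forall y, val (h y) = g (val y).

Definition good g B : Prop := exists C, transports g B C.

Lemma Sim_bij B C (h : B -> C) : Sim h ->
  exists h' : C -> B, [/\ cancel h h', cancel h' h & Sim h'].
Proof.
move=> hS; have [l l0 [hl hs]] := Sim_similarity SimP hS.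
have h_inj : injective h.
  move=> y z hyz; apply/val_inj/mdist_positivity; have := hl y z.
  by rewrite hyz mdistxx => /esym/eqP; rewrite mulf_eq0 gt_eqF//= => /eqP.
have h_surj z : exists y, h y = z by have [y _ <-] := hs z I; exists y.
pose h' z := projT1 (cid (h_surj z)).
have h'K : cancel h' h by move=> z; exact: projT2 (cid (h_surj z)).
have hK : cancel h h' by move=> y; apply: h_inj; rewrite h'K.
by exists h'; split => //; exact: (Sim_inv SimP hS).
Qed.

Lemma transports_image g B C : transports g B C -> cball_set C = g @` B.
Proof.
move=> [h hS hg]; have [h' [hK h'K _]] := Sim_bij hS.
apply/seteqP; split => [z Cz|_ [y By <-]].
  pose c : C := exist _ z (mem_set Cz).
  by exists (val (h' c)); [exact/set_mem/valP|rewrite -hg h'K].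
by rewrite -(hg (exist _ y (mem_set By))); exact/set_mem/valP.
Qed.

Lemma transports_inv f g B C : cancel f g -> transports f B C ->
  transports g C B.
Proof.
move=> fK [h hS hf]; have [h' [hK h'K h'S]] := Sim_bij hS.
by exists h' => // z; rewrite -[in RHS](h'K z) hf fK.
Qed.

Lemma good_sub g B C : B `<=` C -> good g C -> good g B.
Proof.
move=> BC [D [h hS hg]]; have [l l0 hl] := Sim_similarity SimP hS.
have [D' [k kh]] := similarity_image_cball Xu l0 hl BC.
exists D', k; first exact: Sim_restrict SimP _ _ _ _ _ _ hS kh.
move=> y; have yC : val y \in (C : set X) by exact/mem_set/BC/set_mem/valP.
case: kh => _ _ /(_ (exist _ (val y) yC) y erefl) ->.
by rewrite hg.
Qed.

(** The set acted upon consists of the families of maps from balls to [X]; the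
    group acts by composition. The class of a ball [B] is the family of all
    maps [val \o h] with [h] in [Sim D B]: it stands for the class of the
    inclusion of [B] when two maps [u] from [B] and [v] from [C] are identified
    if [u = v \o h] for some [h] in [Sim B C]. Taking arbitrary families as
    ambient set makes a quotient unnecessary. *)
Definition embeddings := {classic (forall B : @cballType R X, set (B -> X))}.

Definition ball_class B : embeddings :=
  fun D u => exists2 h : D -> B, Sim h & u = val \o h.

Arguments ball_class : clear implicits.

Lemma ball_class_id B : ball_class B B val.
Proof. by exists idfun => //; exact: Sim_id. Qed.

(** The left-hand side is the translate by [f] of the class of [B]. If it is
    the class of [C], then evaluating both families at [f \o val], which
    belongs to the translate, yields the transport; the converse holds because
    [Sim] is closed under composition and inverses. *)
Lemma ball_class_transport f g B C : cancel f g -> cancel g f ->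
  ((fun D u => ball_class B D (g \o u)) = ball_class C :> embeddings) <->
  transports f B C.
Proof.
move=> fK gK; split => [e|].
  have : ball_class C B (f \o val).
    rewrite -e; have -> : g \o (f \o val) = val :> (B -> X).
      by apply/funext => y /=; rewrite fK.
    exact: ball_class_id.
  by move=> [h hS fh]; exists h => // y; rewrite -[LHS]/((val \o h) y) -fh.
move=> [h hS hf]; apply: functional_extensionality_dep => D; apply/seteqP.
split => u [k kS]; [move=> gu|move=> ->].
  exists (h \o k); first exact: Sim_comp SimP _ _ _ _ _ kS hS.
  apply/funext => y /=; rewrite hf -[val (k y)]/((val \o k) y) -gu /=.
  by rewrite gK.
have [h' [hK h'K h'S]] := Sim_bij hS.
exists (h' \o k); first exact: Sim_comp SimP _ _ _ _ _ kS h'S.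
by apply/funext => y /=; rewrite -[in LHS](h'K (k y)) hf fK.
Qed.

Lemma ball_class_inj : injective ball_class.
Proof.
have sub B C : ball_class B = ball_class C -> B `<=` C.
  move=> e x Bx; have : ball_class C B val by rewrite -e; exact: ball_class_id.
  move=> [h _ vh]; pose b : B := exist _ x (mem_set Bx).
  have -> : x = val (h b) by exact: (congr1 (fun u => u b) vh).
  exact/set_mem/valP.
by move=> B C e; apply/cball_inj/seteqP; split; exact: sub.
Qed.

Definition graph B C (h : B -> C) : set (X * X) :=
  [set (val y, val (h y)) | y in [set: B]].

Hypothesis Xc : compact [set: X].

(** Good balls cover [X] and sub-balls of good balls are good, so a bad ball
    is not inside any member of the cover. *)
Lemma finite_bad g : (forall x, exists2 B, good g B & cball_set B x) ->
  finite_set [set B : cballType | ~ good g B].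
Proof.
move=> gcov.
apply: sub_finite_set (finite_not_inside Xu Xc gcov) => B nB D gD BD.
by case: nB; exact: good_sub gD.
Qed.

(** Take for [B] a maximal good ball for [f] around [x], and for [C] its image:
    a good ball for [g] larger than [C] would be pulled back to a good ball for
    [f] larger than [B]. *)
Lemma maximal_transport f g x : cancel f g -> cancel g f ->
  (forall x, exists2 B, good f B & cball_set B x) ->
  exists B C, [/\ cball_set B x, transports f B C,
    forall D : cballType, B `<` D -> ~ good f D &
    forall D : cballType, C `<` D -> ~ good g D].
Proof.
move=> fK gK fcov; have [B0 B0good B0x] := fcov x.
have [B [[C BC] B0B Bmax]] := exists_maximal Xu Xc B0good.
exists B, C; split => //; first exact: B0B.
  by move=> D [BD nDB] Dgood; apply: nDB; rewrite (Bmax D).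
move=> D [CD nDC] [D' DD']; apply: nDC.
have D'D := transports_inv gK DD'.
have D'B : D' = B.
  apply: Bmax; first by exists D.
  rewrite (transports_image DD') => y By; exists (f y); last exact: fK.
  by apply: CD; rewrite (transports_image BC); exists y.
by rewrite (transports_image D'D) D'B (transports_image BC).
Qed.

(** Such a map is determined by the graphs of its restrictions to the balls
    [B], which belong to the finite sets [Sim B C] with [B] and [C] ranging
    over finitely many balls. *)
Lemma finite_local_maps n : finite_set [set f : X -> X | forall x, exists B C,
  [/\ cball_set B x, transports f B C, ~ deep n B & ~ deep n C]].
Proof.
pose F := [set B : @cballType R X | ~ deep n B].
have Ffin : finite_set F by exact: finite_shallow.
pose T : set (set (X * X)) :=
  \bigcup_(B in F) \bigcup_(C in F) (@graph B C @` @Sim B C).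
have Tfin : finite_set T.
  apply: bigcup_finite => // B _; apply: bigcup_finite => // C _.
  exact: finite_image (Sim_finite SimP _ _).
apply: (@finite_set_encode _ {classic (set (X * X))} _ T
  (fun f => [set t | T t /\ t `<=` [set p | p.2 = f p.1]])) => //.
  by move=> f _ t [Tt _]; exact: Tt.
move=> f f'; rewrite !in_setE => fP _ ff'; apply/funext => x.
have [B [C [Bx [h hS hf] nB nC]]] := fP x.
have : [set t | T t /\ t `<=` [set p | p.2 = f p.1]] (graph h).
  split; first by exists B => //; exists C => //; exists h.
  by move=> _ [y _ <-] /=; rewrite hf.
rewrite ff' => -[_ /(_ (x, f x))]; apply.
by exists (exist _ x (mem_set Bx)) => //; congr pair; exact: hf.
Qed.

End Transport.
Arguments ball_class {R X} Sim B _ _.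

(** * The Haagerup property *)

Theorem theorem1p1 (R : realType) (X : metricType R)
    (X_ultrametric : ultrametric X) (X_compact : compact [set: X])
    (Gamma : groupClosed (LS X)) :
  locally_finitely_determined Gamma -> haagerup R (subgroup Gamma).
Proof.
move=> [Sim [SimP SimG]].
pose fn (g : subgroup Gamma) : X -> X := ls_fun (val g).
have fnM g h x : fn (g * h)%g x = fn g (fn h x) by [].
have fn1 x : fn 1%g x = x by [].
have fnK g : cancel (fn g) (fn g^-1%g) by move=> x; rewrite -fnM mulVg fn1.
have fnVK g : cancel (fn g^-1%g) (fn g) by move=> x; rewrite -fnM mulgV fn1.
have fn_good g x : exists2 B, good Sim (fn g) B & cball_set B x.
  have [r [l [h [hg _ hS]]]] := SimG _ (valP g) x.
  exists (mk_cball x r); last exact: mk_cball_center.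
  by exists (mk_cball (fn g x) (l%:num * r%:num)%:pos), h.
pose act (g : subgroup Gamma) (e : embeddings) : embeddings :=
  fun B u => e B (fn g^-1%g \o u).
have act1 e : act 1%g e = e.
  rewrite /act invg1; apply: functional_extensionality_dep => B.
  apply: functional_extensionality_dep => u.
  by congr (e B _); apply/funext => y /=; rewrite fn1.
have actM g h e : act (g * h)%g e = act g (act h e).
  apply: functional_extensionality_dep => B.
  apply: functional_extensionality_dep => u.
  by rewrite /act; congr (e B _); apply/funext => y /=; rewrite invgM fnM.
pose Z : set embeddings := range (ball_class Sim).
have actP g B C : act g (ball_class Sim B) = ball_class Sim C <->
    transports Sim (fn g) B C.
  exact: ball_class_transport.
have act_Z g B : Z (act g (ball_class Sim B)) <-> good Sim (fn g) B.
  by split=> [[C _ /esym/actP]|[C /actP BC]]; exists C.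
have act_inj g : injective (act g).
  by move=> e e' ee'; rewrite -[e]act1 -[e']act1 -(mulVg g) !actM ee'.
pose bad g := [set B : cballType | ~ good Sim (fn g) B].
have movedE g : (act g @` Z) `+` Z =
    (act g \o ball_class Sim) @` bad g `|` ball_class Sim @` bad g^-1%g.
  congr (_ `|` _); apply/seteqP; split.
  - move=> _ [[_ [B _ <-] <-] nZ]; exists B => // /act_Z; exact: nZ.
  - move=> _ [B nB <-]; split.
      by exists (ball_class Sim B) => //; exists B.
    by move=> /act_Z; exact: nB.
  - move=> _ [[B _ <-] ngZ]; exists B => // /act_Z gB; apply: ngZ.
    by exists (act g^-1%g (ball_class Sim B)) => //; rewrite -actM mulgV act1.
  - move=> _ [B nB <-]; split; first by exists B.
    by move=> [e Ze eB]; apply/nB/act_Z; rewrite -eB -actM mulVg act1.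
have moved_fin g : finite_set ((act g @` Z) `+` Z).
  rewrite movedE finite_setU; split; apply: finite_image;
    exact: finite_bad.
apply: (@haagerup_of_commensurated_set R _ _ act Z) => // n.
pose K := [set f : X -> X | forall x, exists B C,
  [/\ cball_set B x, transports Sim f B C, ~ deep n.+1 B & ~ deep n.+1 C]].
have Kfin : finite_set K by exact: finite_local_maps.
have fn_inj : injective fn by move=> g h /ls_fun_inj/val_inj.
apply: sub_finite_set (finite_preimage (f := fn) _ Kfin); last first.
  by move=> g h _ _; exact: fn_inj.
move=> g; rewrite /= => gn x.
have [B [C [Bx BC Bmax Cmax]]] :=
  maximal_transport X_ultrametric SimP X_compact x
    (fnK g) (fnVK g) (fn_good g).
(* The balls strictly above [B], resp. [C], are bad for [g], resp. for its
   inverse; each of them contributes its own moved point. *)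
exists B, C; split => //.
  move=> /(deep_card (f := act g \o ball_class Sim) (moved_fin g)) h.
  suff : (n.+1 <= n)%N by rewrite ltnn.
  apply: leq_trans (h _ _) gn.
    exact: inj_comp (act_inj g) (@ball_class_inj _ _ _ SimP).
  by move=> D /Bmax Dbad; rewrite movedE; left; exists D.
move=> /(deep_card (f := ball_class Sim) (moved_fin g)) h.
suff : (n.+1 <= n)%N by rewrite ltnn.
apply: leq_trans (h _ _) gn; first exact: ball_class_inj.
by move=> D /Cmax Dbad; rewrite movedE; right; exists D.
Qed.
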